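(* Let $k$ be an algebraically closed field of characteristic zero and let $n\ge 2$. Let $P_{n,\tau}=\mathrm{PGL}_n\rtimes\langle\tau\rangle$, where $\tau$ has order two and acts on $\mathrm{PGL}_n$ by $\tau(h)=(h^{-1})^t$. Let $X$ be an irreducible $P_{n,\tau}$-variety which is generically free as a $\mathrm{PGL}_n$-variety, so that $A=k_n(X)$ is a central simple algebra of degree $n$. Then the action of $\tau$ on $X$ induces an involution $\sigma_{X,\tau}$ of $A$ as follows: for $f\in A$, $$\sigma_{X,\tau}(f)=\text{transposition}\circ f\circ\tau,$$ that is, $\sigma_{X,\tau}(f)(x)=f(\tau x)^t$ for $x\in X$ in general position.
   Context: Conventions: All involutions are $k$-linear; an involution of a $k$-algebra is an anti-automorphism $\sigma$ with $\sigma^2=\mathrm{id}$. $a^t$ denotes the transpose of a matrix $a$, and for $h\in\mathrm{PGL}_n=\mathrm{PGL}_n(k)$, $h^t$ denotes the class of the transpose of a matrix representing $h$. $\mathrm{PGL}_n$ is identified with the subgroup $\mathrm{PGL}_n\times 1$ of $P_{n,\tau}$. ''In general position'' means in some dense open subset. A $G$-variety is generically free if points in general position have trivial stabilizer in $G$. For an irreducible, generically free $\mathrm{PGL}_n$-variety $X$, $k_n(X)$ denotes the set of $\mathrm{PGL}_n$-equivariant rational maps $X\dashrightarrow \mathrm{M}_n=\mathrm{M}_n(k)$ ($\mathrm{PGL}_n$ acting on $\mathrm{M}_n$ by conjugation), with pointwise addition and multiplication; it is a central simple algebra of degree $n$ (known fact). *)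

(* Defs.v *)
From HB Require Import structures.
From mathcomp Require Import all_boot all_order all_algebra.
From mathcomp Require Import boolp classical_sets.
From mathcomp Require Import mpoly.

Set Implicit Arguments.
Unset Strict Implicit.
Unset Printing Implicit Defensive.

Import GRing.Theory.
Local Open Scope ring_scope.
Local Open Scope quotient_scope.
Local Open Scope classical_set_scope.

(* Varieties over an algebraically closed field k are classical varieties in the
   style of Serre's FAC: the set of (closed) points, together with a finite
   atlas of affine charts identifying subsets with Zariski-closed subsets of
   affine spaces k^d. Points of k^d are row vectors v, at which a polynomial
   p : {mpoly k[d]} takes the value p.@[v 0]. *)

Section Atlas.
Variable k : closedFieldType.

Record atlas (T : Type) := Atlas {
  chart : finType;
  cdim : chart -> nat;
  cdom : chart -> set T;
  ccoord : forall i : chart, T -> 'rV[k]_(cdim i)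
}.

(* The Zariski topology: U is open iff, in each chart, it is the locus where
   some set of polynomials do not all vanish. *)
Definition zopen T (A : atlas T) (U : set T) : Prop :=
  forall i : chart A, exists S : set {mpoly k[cdim i]},
    forall x, cdom i x -> (U x <-> exists2 p, S p & p.@[ccoord i x 0] != 0).

Definition zdense T (A : atlas T) (U : set T) : Prop :=
  forall V, zopen A V -> V !=set0 -> (U `&` V) !=set0.

(* f is regular on U: near each point of U it is, in each chart around that
   point, a quotient of two polynomials in the coordinates. *)
Definition regular T (A : atlas T) (U : set T) (f : T -> k) : Prop :=
  forall (x : T) (i : chart A), U x -> cdom i x ->
    exists (V : set T) (p q : {mpoly k[cdim i]}),
      [/\ zopen A V, V x, V `<=` U `&` cdom i &
          forall y, V y ->
            q.@[ccoord i y 0] != 0 /\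
            f y = p.@[ccoord i y 0] / q.@[ccoord i y 0]].

Definition is_morphism S T (A : atlas S) (B : atlas T) (f : S -> T) : Prop :=
  (forall V, zopen B V -> zopen A (f @^-1` V)) /\
  (forall V g, zopen B V -> regular B V g -> regular A (f @^-1` V) (g \o f)).

Definition prod_atlas S T (A : atlas S) (B : atlas T) : atlas (S * T) :=
  @Atlas (S * T)%type (chart A * chart B)%type
    (fun ij => (cdim ij.1 + cdim ij.2)%N)
    (fun ij => cdom ij.1 `*` cdom ij.2)
    (fun ij x => row_mx (ccoord ij.1 x.1) (ccoord ij.2 x.2)).

Record is_variety T (A : atlas T) : Prop := IsVariety {
  dom_cover : forall x, exists i : chart A, cdom i x;
  dom_open : forall i : chart A, zopen A (cdom i);
  coord_inj : forall (i : chart A) x y,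
    cdom i x -> cdom i y -> ccoord i x = ccoord i y -> x = y;
  coord_closed : forall i : chart A, exists S : set {mpoly k[cdim i]},
    ccoord i @` cdom i = [set v | forall p, S p -> p.@[v 0] = 0];
  (* the transition functions between charts are regular *)
  coord_regular : forall (j : chart A) (l : 'I_(cdim j)),
    regular A (cdom j) (fun x => ccoord j x 0 l);
  (* the diagonal is closed in the product *)
  separated : zopen (prod_atlas A A) [set xy | xy.1 <> xy.2]
}.

Record variety := Variety {
  point :> Type;
  var_atlas : atlas point;
  varP : is_variety var_atlas
}.

Definition irreducible (X : variety) : Prop :=
  [set: X] !=set0 /\
  forall U V, zopen (var_atlas X) U -> zopen (var_atlas X) V ->
    U !=set0 -> V !=set0 -> (U `&` V) !=set0.

(* P holds for x in X in general position. *)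
Definition generic (X : variety) (P : X -> Prop) : Prop :=
  exists U : set X,
    [/\ zopen (var_atlas X) U, zdense (var_atlas X) U & forall x, U x -> P x].

Record gvariety (G : groupType) (AG : atlas G) := GVariety {
  gvar :> variety;
  gact : G -> gvar -> gvar;
  gact1 : forall x, gact 1%g x = x;
  gactM : forall g h x, gact (g * h)%g x = gact g (gact h x);
  gact_morphism : is_morphism (prod_atlas AG (var_atlas gvar)) (var_atlas gvar)
                    (fun gx => gact gx.1 gx.2)
}.

Record irr_gvariety (G : groupType) (AG : atlas G) := IrrGVariety {
  igvar :> gvariety AG;
  igvarP : irreducible igvar
}.

Definition generically_free (G : groupType) (AG : atlas G) (X : gvariety AG) :
    Prop :=
  generic (fun x : X => forall g : G, gact g x = x -> g = 1%g).

End Atlas.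

Section Groups.
Variables (k : closedFieldType) (n : nat).

(* Matrices have size n.+1, so that they form an algType. *)

Record GL := GLmx { glval :> 'M[k]_n.+1; glP : glval \is a GRing.unit }.
HB.instance Definition _ := [isSub for glval].
HB.instance Definition _ := [Choice of GL by <:].

Lemma GLmul_subproof (a b : GL) : glval a * glval b \is a GRing.unit.
Proof. by rewrite unitrMl ?(glP a, glP b). Qed.
Lemma GLinv_subproof (a : GL) : (glval a)^-1 \is a GRing.unit.
Proof. by rewrite unitrV (glP a). Qed.
Lemma GLtr_subproof (a : GL) : (glval a)^T \is a GRing.unit.
Proof.
have : (glval a)^T \in unitmx by rewrite unitmx_tr; exact: (glP a).
exact.
Qed.

Definition GL1 : GL := GLmx (unitr1 _).
Definition GLmul (a b : GL) : GL := GLmx (GLmul_subproof a b).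
Definition GLinv (a : GL) : GL := GLmx (GLinv_subproof a).
Definition GLtr (a : GL) : GL := GLmx (GLtr_subproof a).

Definition proportional (a b : GL) : bool :=
  `[< exists2 c : k, c != 0 & glval a = c *: glval b >].

Lemma proportionalP a b :
  reflect (exists2 c : k, c != 0 & glval a = c *: glval b) (proportional a b).
Proof. exact: asboolP. Qed.

Lemma proportional_refl : reflexive proportional.
Proof.
by move=> a; apply/proportionalP; exists 1; rewrite ?oner_neq0 ?scale1r.
Qed.

Lemma proportional_sym : ssrbool.symmetric proportional.
Proof.
suff H a b : proportional a b -> proportional b a by move=> a b; apply/idP/idP => /H.
move=> /proportionalP[c c0 e]; apply/proportionalP; exists c^-1.
  by rewrite invr_neq0.
by rewrite e scalerA mulVf // scale1r.
Qed.

Lemma proportional_trans : transitive proportional.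
Proof.
move=> b a c /proportionalP[x x0 e] /proportionalP[y y0 e'].
apply/proportionalP; exists (x * y); first by rewrite mulf_neq0.
by rewrite e e' scalerA.
Qed.

Canonical proportional_equiv :=
  EquivRel proportional proportional_refl proportional_sym proportional_trans.

Definition PGL := {eq_quot proportional}.
HB.instance Definition _ : EqQuotient _ proportional PGL := EqQuotient.on PGL.
HB.instance Definition _ := Choice.on PGL.

Definition PGL1 : PGL := lift_cst PGL GL1.
Definition PGLmul : PGL -> PGL -> PGL := lift_op2 PGL GLmul.
Definition PGLinv : PGL -> PGL := lift_op1 PGL GLinv.
Definition PGLtr : PGL -> PGL := lift_op1 PGL GLtr.

Lemma eq_PGL (a b : GL) (c : k) :
  c != 0 -> glval a = c *: glval b -> \pi_PGL a = \pi_PGL b.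
Proof. by move=> c0 e; apply/eqmodP/proportionalP; exists c. Qed.

Lemma PGL_eq (a b : GL) : \pi_PGL a = \pi_PGL b ->
  exists2 c : k, c != 0 & glval a = c *: glval b.
Proof. by move/eqmodP/proportionalP. Qed.

Lemma pi_PGL1 : \pi_PGL GL1 = PGL1.
Proof. by rewrite /PGL1; unlock. Qed.

Lemma pi_PGLmul : {morph \pi_PGL : a b / GLmul a b >-> PGLmul a b}.
Proof.
move=> a b; unlock PGLmul.
have [c c0 e] := PGL_eq (esym (reprK (\pi_PGL a))).
have [d d0 e'] := PGL_eq (esym (reprK (\pi_PGL b))).
apply: (@eq_PGL _ _ (c * d)); first by rewrite mulf_neq0.
by rewrite /= e e' -scalerAl -scalerAr scalerA.
Qed.

Lemma pi_PGLinv : {morph \pi_PGL : a / GLinv a >-> PGLinv a}.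
Proof.
move=> a; unlock PGLinv.
have [c c0 e] := PGL_eq (esym (reprK (\pi_PGL a))).
apply: (@eq_PGL _ _ c^-1); first by rewrite invr_neq0.
by rewrite /= {1}e invrZ ?unitfE // (glP (repr _)).
Qed.

Lemma pi_PGLtr : {morph \pi_PGL : a / GLtr a >-> PGLtr a}.
Proof.
move=> a; unlock PGLtr.
have [c c0 e] := PGL_eq (esym (reprK (\pi_PGL a))).
by apply: (@eq_PGL _ _ c) => //=; rewrite {1}e linearZ.
Qed.

Lemma PGLmulA : associative PGLmul.
Proof.
elim/quotW=> a; elim/quotW=> b; elim/quotW=> c.
by rewrite -!pi_PGLmul; congr \pi; apply: val_inj; rewrite /= mulrA.
Qed.

Lemma PGLmul1 : left_id PGL1 PGLmul.
Proof.
elim/quotW=> a; rewrite -pi_PGL1 -pi_PGLmul; congr \pi.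
by apply: val_inj; rewrite /= mul1r.
Qed.

Lemma PGLmulr1 : right_id PGL1 PGLmul.
Proof.
elim/quotW=> a; rewrite -pi_PGL1 -pi_PGLmul; congr \pi.
by apply: val_inj; rewrite /= mulr1.
Qed.

Lemma PGLmulV : left_inverse PGL1 PGLinv PGLmul.
Proof.
elim/quotW=> a; rewrite -pi_PGL1 -pi_PGLinv -pi_PGLmul; congr \pi.
by apply: val_inj; rewrite /= mulVr // (glP a).
Qed.

Lemma PGLmulrV : right_inverse PGL1 PGLinv PGLmul.
Proof.
elim/quotW=> a; rewrite -pi_PGL1 -pi_PGLinv -pi_PGLmul; congr \pi.
by apply: val_inj; rewrite /= divrr // (glP a).
Qed.

HB.instance Definition _ :=
  isGroup.Build PGL PGLmulA PGLmul1 PGLmulr1 PGLmulV PGLmulrV.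

(* PGL_n as an affine open subvariety of P(M_n): on the chart (i, j) the class
   of h has h i j != 0, and its coordinates are the entries of the
   representative a with a i j = 1, followed by 1 / det a. *)
Definition PGLdom (ij : 'I_n.+1 * 'I_n.+1) : set PGL :=
  [set h | glval (repr h) ij.1 ij.2 != 0].

Definition PGLcoord (ij : 'I_n.+1 * 'I_n.+1) (h : PGL) :
    'rV[k]_(n.+1 * n.+1 + 1) :=
  let a := (glval (repr h) ij.1 ij.2)^-1 *: glval (repr h) in
  row_mx (mxvec a) (\det a)^-1%:M.

Definition PGL_atlas : atlas k PGL := Atlas PGLdom PGLcoord.

Definition tau (h : PGL) : PGL := PGLtr (h^-1)%g.

Lemma tauM : {morph tau : g h / (g * h)%g}.
Proof.
elim/quotW=> a; elim/quotW=> b; rewrite /tau.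
rewrite -[LHS]/(PGLtr (PGLinv (PGLmul _ _))) -[RHS]/(PGLmul (PGLtr (PGLinv _)) (PGLtr (PGLinv _))).
rewrite -!(pi_PGLmul, pi_PGLinv, pi_PGLtr); congr \pi; apply: val_inj => /=.
by rewrite invrM ?(glP a) ?(glP b) // [LHS]trmx_mul.
Qed.

Lemma tau1 : tau 1%g = 1%g.
Proof.
rewrite -[LHS]/(PGLtr (PGLinv PGL1)) -[RHS]/PGL1.
rewrite -pi_PGL1 -pi_PGLinv -pi_PGLtr; congr \pi; apply: val_inj => /=.
by rewrite invr1 [LHS]trmx1.
Qed.

Lemma tauK : involutive tau.
Proof.
elim/quotW=> a; rewrite -[LHS]/(PGLtr (PGLinv (PGLtr (PGLinv _)))).
rewrite -!(pi_PGLinv, pi_PGLtr); congr \pi; apply: val_inj => /=.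
by rewrite -[X in X^T]/(invmx _) trmx_inv trmxK -[LHS]/(_^-1^-1) invrK.
Qed.

(* The semidirect product of PGL_n and <tau>; (h, b) stands for h * tau ^ b. *)
Definition PGLtau : Type := (PGL * bool)%type.
HB.instance Definition _ := Choice.on PGLtau.

Definition twist (b : bool) (h : PGL) : PGL := if b then tau h else h.

Definition PGLtau_mul (g h : PGLtau) : PGLtau :=
  ((g.1 * twist g.2 h.1)%g, g.2 (+) h.2).
Definition PGLtau_one : PGLtau := (1%g, false).
Definition PGLtau_inv (g : PGLtau) : PGLtau := (twist g.2 (g.1^-1)%g, g.2).

Lemma PGLtau_mulA : associative PGLtau_mul.
Proof.
move=> [g a] [h b] [l c]; rewrite /PGLtau_mul /= addbA; congr (_, _).
by case: a; case: b; rewrite /= ?tauM ?tauK mulgA.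
Qed.

Lemma PGLtau_mul1 : left_id PGLtau_one PGLtau_mul.
Proof. by move=> [g a]; rewrite /PGLtau_mul /= mul1g. Qed.

Lemma PGLtau_mulr1 : right_id PGLtau_one PGLtau_mul.
Proof.
by move=> [g a]; rewrite /PGLtau_mul /=; case: a; rewrite /= ?tau1 mulg1.
Qed.

Lemma PGLtau_mulV : left_inverse PGLtau_one PGLtau_inv PGLtau_mul.
Proof.
move=> [g a]; rewrite /PGLtau_mul /PGLtau_inv /= addbb; congr (_, _).
by case: a; rewrite /= -?tauM mulVg ?tau1.
Qed.

Lemma PGLtau_mulrV : right_inverse PGLtau_one PGLtau_inv PGLtau_mul.
Proof.
move=> [g a]; rewrite /PGLtau_mul /PGLtau_inv /= addbb; congr (_, _).
by case: a; rewrite /= ?tauK mulgV.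
Qed.

HB.instance Definition _ := isGroup.Build PGLtau PGLtau_mulA PGLtau_mul1
  PGLtau_mulr1 PGLtau_mulV PGLtau_mulrV.

Definition tau_elt : PGLtau := (1%g, true).
Definition PGL_incl (h : PGL) : PGLtau := (h, false).

(* The disjoint union of two copies of PGL_n. *)
Definition PGLtau_atlas : atlas k PGLtau :=
  @Atlas k PGLtau (chart PGL_atlas * bool)%type (fun ib => cdim ib.1)
    (fun ib => [set g | cdom ib.1 g.1 /\ g.2 = ib.2])
    (fun ib g => ccoord ib.1 g.1).

End Groups.

Section Restriction.
Variables (k : closedFieldType) (n : nat) (X : irr_gvariety (PGLtau_atlas k n)).

Let act (h : PGL k n) (x : X) : X := gact (PGL_incl h) x.

Lemma restr_act1 x : act 1%g x = x.
Proof. exact: gact1. Qed.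

Lemma restr_actM g h x : act (g * h)%g x = act g (act h x).
Proof. by rewrite /act -gactM. Qed.

Lemma restr_morphism :
  is_morphism (prod_atlas (PGL_atlas k n) (var_atlas X)) (var_atlas X)
    (fun gx => act gx.1 gx.2).
Proof.
set A := prod_atlas _ _.
set B := prod_atlas (PGLtau_atlas k n) (var_atlas X).
pose iota (p : PGL k n * X) : PGLtau k n * X := (PGL_incl p.1, p.2).
have iopen V : zopen B V -> zopen A (iota @^-1` V).
  move=> oV [i j]; have [S HS] := oV ((i, false), j).
  by exists S => x [Dx1 Dx2]; apply: (HS (iota x)); split.
have [cont reg] := gact_morphism X.
split=> [V oV|V g oV rg]; first exact: (iopen _ (cont _ oV)).
move=> x [i j] Ux [Dx1 Dx2].
have [|W [p [q [oW Wx WU Wq]]]] := reg V g oV rg (iota x) ((i, false), j) Ux.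
  by split.
exists (iota @^-1` W), p, q; split=> //; first exact: iopen.
- by move=> y /WU[? [[? _] ?]]; split.
- by move=> y /Wq.
Qed.

(* X viewed as a PGL_n-variety, via h |-> (h, 1). *)
Definition restrict : irr_gvariety (PGL_atlas k n) :=
  @IrrGVariety k _ _ (GVariety restr_act1 restr_actM restr_morphism) (igvarP X).

End Restriction.

Section Zariski.
Variables (k : closedFieldType) (T : Type) (A : atlas k T).

Lemma zopenT : zopen A setT.
Proof.
move=> i; exists [set 1] => x Dx; split=> // _.
by exists 1; rewrite ?meval1 ?oner_neq0.
Qed.

Lemma zopenI U V : zopen A U -> zopen A V -> zopen A (U `&` V).
Proof.
move=> oU oV i; have [S HS] := oU i; have [S' HS'] := oV i.
exists [set r | exists p q, [/\ S p, S' q & r = p * q]] => x Dx.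
split=> [[/(HS _ Dx)[p Sp p0] /(HS' _ Dx)[q Sq q0]]|[_ [p [q [Sp Sq ->]]]]].
  by exists (p * q); [exists p, q | rewrite mevalM mulf_neq0].
rewrite mevalM mulf_eq0 negb_or => /andP[p0 q0]; split.
  by apply/(HS _ Dx); exists p.
by apply/(HS' _ Dx); exists q.
Qed.

Lemma zdenseT : zdense A setT.
Proof. by move=> V _; rewrite setTI. Qed.

Lemma zdenseI U V : zopen A V -> zdense A U -> zdense A V -> zdense A (U `&` V).
Proof.
move=> oV dU dV W oW W0; rewrite -setIA; apply: dU; first exact: zopenI.
exact: dV.
Qed.

Lemma regularS U V f :
  zopen A V -> V `<=` U -> regular A U f -> regular A V f.
Proof.
move=> oV VU rf x i Vx Dx; have [W [p [q [oW Wx WU Wq]]]] := rf x i (VU _ Vx) Dx.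
exists (W `&` V), p, q; split=> //; first exact: zopenI.
  by move=> y [/WU[_ ?] ?].
by move=> y [/Wq].
Qed.

Lemma regular_cst U c : zopen A U -> (forall i : chart A, zopen A (cdom i)) ->
  regular A U (fun=> c).
Proof.
move=> oU oD x i Ux Dx; exists (U `&` cdom i), c%:MP, 1; split=> //.
  exact: zopenI.
by move=> y _; rewrite meval1 mevalC oner_neq0 divr1.
Qed.

Lemma regularD U f g : regular A U f -> regular A U g ->
  regular A U (fun x => f x + g x).
Proof.
move=> rf rg x i Ux Dx.
have [V [p [q [oV Vx VU Vq]]]] := rf x i Ux Dx.
have [V' [p' [q' [oV' Vx' VU' Vq']]]] := rg x i Ux Dx.
exists (V `&` V'), (p * q' + p' * q), (q * q'); split=> //.
- exact: zopenI.
- by move=> y [/VU].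
- move=> y [/Vq[q0 ->] /Vq'[q0' ->]]; rewrite mevalD !mevalM mulf_neq0 //.
  by rewrite addf_div.
Qed.

Lemma regularM U f g : regular A U f -> regular A U g ->
  regular A U (fun x => f x * g x).
Proof.
move=> rf rg x i Ux Dx.
have [V [p [q [oV Vx VU Vq]]]] := rf x i Ux Dx.
have [V' [p' [q' [oV' Vx' VU' Vq']]]] := rg x i Ux Dx.
exists (V `&` V'), (p * p'), (q * q'); split=> //.
- exact: zopenI.
- by move=> y [/VU].
- move=> y [/Vq[q0 ->] /Vq'[q0' ->]]; rewrite !mevalM mulf_neq0 //.
  by rewrite mulf_div.
Qed.

Lemma regular_sum (I : Type) (r : seq I) U (F : I -> T -> k) :
  zopen A U -> (forall i : chart A, zopen A (cdom i)) ->
  (forall l, regular A U (F l)) -> regular A U (fun x => \sum_(l <- r) F l x).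
Proof.
move=> oU oD rF; elim: r => [|l r IH].
  rewrite (_ : (fun x => _) = fun=> 0); first exact: regular_cst.
  by apply/funext => x; rewrite big_nil.
rewrite (_ : (fun x => _) = fun x => F l x + \sum_(j <- r) F j x).
  exact: regularD.
by apply/funext => x; rewrite big_cons.
Qed.

End Zariski.

Section PGLVariety.
Variables (k : closedFieldType) (n : nat).
Notation PGL := (PGL k n).
Notation N := (n.+1 * n.+1 + 1)%N.

Let ent (h : PGL) (a b : 'I_n.+1) : k := glval (repr h) a b.
Let Xv (a b : 'I_n.+1) : {mpoly k[N]} := 'X_(lshift 1 (mxvec_index a b)).
Let Td : {mpoly k[N]} := 'X_(rshift _ ord0).

Let XvE ij (h : PGL) a b :
  (Xv a b).@[PGLcoord ij h 0] = (ent h ij.1 ij.2)^-1 * ent h a b.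
Proof. by rewrite mevalXU row_mxEl mxvecE mxE. Qed.

Let TdE ij (h : PGL) :
  Td.@[PGLcoord ij h 0] =
  (\det ((ent h ij.1 ij.2)^-1 *: glval (repr h)))^-1.
Proof. by rewrite mevalXU row_mxEr mxE eqxx mulr1n. Qed.

Let PGL_opendom ij : zopen (PGL_atlas k n) (PGLdom ij).
Proof.
move=> kl; exists [set Xv ij.1 ij.2] => h Dh; split=> [Ih|[_ -> ]].
  by exists (Xv ij.1 ij.2) => //; rewrite XvE mulf_neq0 // invr_neq0.
by rewrite XvE mulf_eq0 negb_or => /andP[].
Qed.

Lemma PGL_entries (g h : PGL) :
  g = h <-> forall a b c d, ent g a b * ent h c d = ent g c d * ent h a b.
Proof.
split=> [->|H]; first by move=> *; rewrite mulrC.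
have [i [j hij]] : exists i j, ent h i j != 0.
  apply: contrapT => H0; have := glP (repr h).
  rewrite (_ : glval (repr h) = 0) ?unitr0 //; apply/matrixP => i j.
  rewrite mxE; apply: contrapT => /eqP e; apply: H0.
  by exists i, j.
have e : glval (repr g) = (ent g i j / ent h i j) *: glval (repr h).
  apply/matrixP => a b; rewrite mxE mulrAC; apply: canRL (mulfK hij) _.
  exact: H.
rewrite -[LHS]reprK -[RHS]reprK; apply: (eq_PGL _ e); apply/negP => /eqP c0.
have := glP (repr g).
by rewrite e c0 scale0r unitr0.
Qed.

Let detP : {mpoly k[N]} := \det (\matrix_(a, b) Xv a b).

Let detPE (v : 'rV[k]_N) : detP.@[v 0] = \det (vec_mx (lsubmx v)).
Proof.
rewrite -det_map_mx; congr (\det _); apply/matrixP => a b.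
by rewrite !mxE; exact: mevalXU.
Qed.

Let det_renorm (u d : k) (M : 'M[k]_n.+1) : u != 0 ->
  (\det (d^-1 *: M))^-1 = (u^-1 * d) ^+ n.+1 * (\det (u^-1 *: M))^-1.
Proof.
move=> u0; have -> : d^-1 *: M = (u^-1 * d)^-1 *: (u^-1 *: M).
  by rewrite scalerA invfM invrK mulrAC mulfV ?mul1r.
by rewrite [in LHS]detZ invfM exprVn invrK.
Qed.

Lemma PGL_is_variety : is_variety (PGL_atlas k n).
Proof.
split.
- move=> h; apply: contrapT => H0; have := glP (repr h).
  rewrite (_ : glval (repr h) = 0) ?unitr0 //; apply/matrixP => i j.
  rewrite mxE; apply: contrapT => /eqP e; apply: H0.
  by exists (i, j).
- exact: PGL_opendom.
- move=> ij g h Dg Dh /eq_row_mx[/(can_inj mxvecK) e _].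
  apply/PGL_entries => a b c d.
  have E x y : ent g x y = ent g ij.1 ij.2 * ((ent h ij.1 ij.2)^-1 * ent h x y).
    have := congr1 (fun M : 'M[k]_n.+1 => ent g ij.1 ij.2 * M x y) e.
    by rewrite !mxE mulrA mulfV // mul1r.
  rewrite (E a b) (E c d) -!mulrA; congr (_ * (_ * _)); exact: mulrC.
- move=> ij; exists [set Xv ij.1 ij.2 - 1; Td * detP - 1].
  apply/seteqP; split=> [_ [h Dh <-] p [] ->|v Hv].
  + by rewrite mevalB meval1 XvE mulVf ?subrr.
  + rewrite mevalB mevalM meval1 TdE detPE row_mxKl mxvecK mulVf ?subrr //.
    rewrite detZ mulf_neq0 ?expf_neq0 ?invr_neq0 //.
    by have := glP (repr h); rewrite -unitfE.
  have := Hv _ (or_introl erefl); have := Hv _ (or_intror erefl).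
  rewrite !mevalB mevalM !meval1 detPE !mevalXU => /eqP.
  rewrite subr_eq0 => /eqP eT /eqP; rewrite subr_eq0 => /eqP e1.
  set M := vec_mx (lsubmx v) in eT.
  have MU : M \is a GRing.unit.
    have : M \in unitmx.
      rewrite unitmxE unitfE; apply/eqP => d0; move: eT.
      by rewrite d0 mulr0 => /eqP; rewrite eq_sym oner_eq0.
    exact.
  pose h : PGL := \pi_PGL (GLmx MU).
  have [c c0 e] : exists2 c, c != 0 & glval (repr h) = c *: M.
    by apply: (@PGL_eq _ _ (repr h) (GLmx MU)); rewrite reprK.
  have M1 : M ij.1 ij.2 = 1 by rewrite !mxE.
  exists h; first by rewrite /= /PGLdom /= e mxE M1 mulr1.
  rewrite /= /PGLcoord e mxE M1 mulr1 scalerA mulVf // scale1r vec_mxK.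
  rewrite -[RHS]hsubmxK; congr row_mx; apply/rowP => l; rewrite !ord1 !mxE eqxx.
  have d0 : \det M != 0.
    by apply/eqP => d0; move/eqP: eT; rewrite d0 mulr0 eq_sym oner_eq0.
  by rewrite mulr1n; apply: (mulIf d0); rewrite mulVf // eT.
- move=> ij l h kl Dij Dkl.
  have oV : zopen (PGL_atlas k n) (PGLdom ij `&` PGLdom kl).
    exact: zopenI (PGL_opendom ij) (PGL_opendom kl).
  case: (split_ordP l) => m ->.
  + case/mxvec_indexP: m => a b.
    exists (PGLdom ij `&` PGLdom kl), (Xv a b), (Xv ij.1 ij.2); split=> //.
    move=> g [Gij Gkl]; rewrite !XvE mulf_neq0 ?invr_neq0 //; split=> //.
    rewrite /= row_mxEl mxvecE mxE -mulf_div divff ?invr_neq0 // mul1r.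
    by rewrite mulrC.
  + exists (PGLdom ij `&` PGLdom kl), (Xv ij.1 ij.2 ^+ n.+1 * Td), 1; split=> //.
    move=> g [Gij Gkl]; rewrite meval1 oner_neq0 divr1; split=> //.
    rewrite mevalM rmorphXn /= XvE TdE /= row_mxEr ord1 mxE eqxx mulr1n.
    exact: det_renorm.
- move=> [ij kl].
  exists [set r | exists a b c d, r =
    'X_(lshift N (lshift 1 (mxvec_index a b)))
      * 'X_(rshift N (lshift 1 (mxvec_index c d)))
    - 'X_(lshift N (lshift 1 (mxvec_index c d)))
      * 'X_(rshift N (lshift 1 (mxvec_index a b)))].
  move=> [g h] [/= Dg Dh].
  have E a b c d : ('X_(lshift N (lshift 1 (mxvec_index a b)))
      * 'X_(rshift N (lshift 1 (mxvec_index c d)))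
    - 'X_(lshift N (lshift 1 (mxvec_index c d)))
      * 'X_(rshift N (lshift 1 (mxvec_index a b)))).@[
        row_mx (PGLcoord ij g) (PGLcoord kl h) 0] =
     ((ent g ij.1 ij.2)^-1 * (ent h kl.1 kl.2)^-1) *
     (ent g a b * ent h c d - ent g c d * ent h a b).
    rewrite mevalB !mevalM !mevalXU !row_mxEl !row_mxEr !row_mxEl !mxvecE !mxE.
    by rewrite mulrBr; congr (_ - _); exact: mulrACA.
  split=> [gh|[_ [a [b [c [d ->]]]]]].
    apply: contrapT => H; apply: gh; apply/PGL_entries => a b c d.
    apply: contrapT => /eqP; rewrite -subr_eq0 => H0; apply: H.
    eexists; first by exists a, b, c, d.
    by rewrite E !mulf_neq0 ?invr_neq0.
  rewrite E => H0 gh; move: H0.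
  by rewrite ((PGL_entries g h).1 gh a b c d) subrr mulr0 eqxx.
Qed.
End PGLVariety.

Section PGLtauVariety.
Variables (k : closedFieldType) (n : nat).
Notation PGL := (PGL k n).
Notation PGLtau := (PGLtau k n).
Notation A := (PGL_atlas k n).
Notation B := (PGLtau_atlas k n).

Let copy_open (b : bool) (U : set PGL) : zopen A U ->
  zopen B [set g : PGLtau | U g.1 /\ g.2 = b].
Proof.
move=> oU [i c]; have [->|/eqP bc] := eqVneq b c; last first.
  by exists set0 => -[g c'] [/= _ ->]; split=> [[_ /= e]|[]//]; case: bc.
have [S HS] := oU i; exists S => -[g c'] [/= Dg ->].
split=> [[/= Ug _]|Sg]; first exact/(HS g Dg).
by split=> //=; apply/(HS g Dg).
Qed.

Lemma PGLtau_is_variety : is_variety B.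
Proof.
have [cover opn inj closed reg sep] := PGL_is_variety k n.
split.
- by move=> [g b]; have [i Di] := cover g; exists (i, b).
- by move=> [i b]; exact: copy_open.
- by move=> [i b] [g c] [h d] [/= Dg ->] [/= Dh ->] e; rewrite (inj i g h).
- move=> [i b]; have [S HS] := closed i; exists S; rewrite -HS.
  apply/seteqP; split=> [_ [[g c] [/= Dg _] <-]|_ [g Dg <-]]; first by exists g.
  by exists (g, b).
- move=> [j b] l [g c] [i d] [/= Dj ->] [/= Di bd].
  have [V [p [q [oV Vg Vs Vq]]]] := reg j l g i Dj Di.
  exists [set h : PGLtau | V h.1 /\ h.2 = b], p, q; split=> //.
  + exact: copy_open.
  + by move=> [h e] [/= /Vs[? ?] ->].
  + by move=> [h e] [/= /Vq ? _].
- move=> [[i b] [j c]]; have [S HS] := sep (i, j).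
  have [bc|/eqP bc] := eqVneq b c; last first.
    exists [set 1] => -[[g b'] [h c']] [[/= _ ->] [/= _ ->]].
    split=> [_|_ [_ e]]; last by case: bc.
    by exists 1; rewrite // meval1 oner_neq0.
  exists S => -[[g b'] [h c']] [[/= Dg ->] [/= Dh ->]].
  have H := HS (g, h) (conj Dg Dh); split=> [gh|/H.2 gh [e _]]; last exact: gh.
  by apply/H => /= e; apply: gh; rewrite /= e bc.
Qed.

End PGLtauVariety.

Section Generic.
Variables (k : closedFieldType) (X : variety k).

Lemma genericT (P : X -> Prop) : (forall x, P x) -> generic P.
Proof. by exists setT; split=> //; [exact: zopenT | exact: zdenseT]. Qed.

Lemma generic2 (P Q R : X -> Prop) : (forall x, P x -> Q x -> R x) ->
  generic P -> generic Q -> generic R.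
Proof.
move=> PQR [U [oU dU PU]] [V [oV dV QV]].
exists (U `&` V); split; [exact: zopenI | exact: zdenseI |].
by move=> x [/PU ? /QV ?]; exact: PQR.
Qed.

Lemma generic1 (P R : X -> Prop) : (forall x, P x -> R x) ->
  generic P -> generic R.
Proof. by move=> PR gP; apply: (generic2 _ gP gP) => x _; exact: PR. Qed.

Lemma generic_ex (P : X -> Prop) : irreducible X -> generic P -> exists x, P x.
Proof.
move=> [X0 _] [U [_ dU PU]].
by have [x [Ux _]] := dU _ (@zopenT _ _ _) X0; exists x; exact: PU.
Qed.

End Generic.

Section RatMaps.
Variables (k : closedFieldType) (n : nat) (X : irr_gvariety (PGL_atlas k n)).

Definition conj_act (h : PGL k n) (a : 'M[k]_n.+1) : 'M[k]_n.+1 :=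
  glval (repr h) * a / glval (repr h).

(* A PGL_n-equivariant rational map from X to M_n, represented by a function
   which is regular on a dense open set rdom; its values elsewhere are
   irrelevant. Equivariance says that, for each h, the rational maps
   x |-> f (h x) and x |-> h f(x) h^-1 are equal. *)
Record ratmap := RatMap {
  rfun :> X -> 'M[k]_n.+1;
  rdom : set X;
  rdom_open : zopen (var_atlas X) rdom;
  rdom_dense : zdense (var_atlas X) rdom;
  rfun_regular :
    forall i j, regular (var_atlas X) rdom (fun x => rfun x i j);
  rfun_equiv : forall h : PGL k n,
    generic (fun x : X => rfun (gact h x) = conj_act h (rfun x))
}.

HB.instance Definition _ := gen_eqMixin ratmap.
HB.instance Definition _ := gen_choiceMixin ratmap.

Definition same_ratmap (f g : ratmap) : bool :=
  `[< generic (fun x : X => f x = g x) >].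

Lemma same_ratmapP (f g : ratmap) :
  reflect (generic (fun x : X => f x = g x)) (same_ratmap f g).
Proof. exact: asboolP. Qed.

Lemma same_ratmap_refl : reflexive same_ratmap.
Proof. by move=> f; apply/same_ratmapP/genericT. Qed.

Lemma same_ratmap_sym : ssrbool.symmetric same_ratmap.
Proof.
by move=> f g; apply/same_ratmapP/same_ratmapP; apply: generic1 => x.
Qed.

Lemma same_ratmap_trans : transitive same_ratmap.
Proof.
move=> g f h /same_ratmapP fg /same_ratmapP gh; apply/same_ratmapP.
by apply: generic2 fg gh => x ->.
Qed.

Canonical same_ratmap_equiv :=
  EquivRel same_ratmap same_ratmap_refl same_ratmap_sym same_ratmap_trans.

(* The algebra k_n(X) of PGL_n-equivariant rational maps. *)
Definition kn := {eq_quot same_ratmap}.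
HB.instance Definition _ : EqQuotient _ same_ratmap kn := EqQuotient.on kn.
HB.instance Definition _ := Choice.on kn.

Lemma eq_kn (f g : ratmap) :
  generic (fun x : X => f x = g x) <-> \pi_kn f = \pi_kn g.
Proof. by split=> [fg|/eqmodP/same_ratmapP //]; apply/eqmodP/same_ratmapP. Qed.

Lemma conj_actD h : {morph conj_act h : a b / a + b}.
Proof. by move=> a b; rewrite /conj_act mulrDr mulrDl. Qed.

Lemma conj_actM h : {morph conj_act h : a b / a * b}.
Proof.
move=> a b; rewrite /conj_act -!mulrA; congr (_ * (_ * _)).
by rewrite mulKr // (glP (repr h)).
Qed.

Lemma conj_actZ h c a : conj_act h (c *: a) = c *: conj_act h a.
Proof. by rewrite /conj_act -scalerAr -scalerAl. Qed.

Lemma conj_act_scalar h c : conj_act h c%:M = c%:M.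
Proof.
rewrite -scalemx1 conj_actZ; congr (_ *: _).
by rewrite /conj_act mulr1 divrr // (glP (repr h)).
Qed.

Let A := var_atlas X.

Lemma dom_openX (i : chart A) : zopen A (cdom i).
Proof. exact: (dom_open (varP X)). Qed.

Lemma rscalar_reg (c : k) i j :
  regular A setT (fun x => (fun=> c%:M : 'M[k]_n.+1) x i j).
Proof. exact: regular_cst (@zopenT _ _ _) dom_openX. Qed.

Lemma rscalar_equiv (c : k) (h : PGL k n) :
  generic (fun x : X => c%:M = conj_act h c%:M).
Proof. by apply: genericT => x; rewrite conj_act_scalar. Qed.

Definition rscalar (c : k) : ratmap :=
  RatMap (@zopenT _ _ _) (@zdenseT _ _ _) (rscalar_reg c) (rscalar_equiv c).

Section Ops.
Variables (f g : ratmap) (c : k).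
Let U := rdom f `&` rdom g.

Lemma rI_open : zopen A U.
Proof. exact: zopenI (rdom_open f) (rdom_open g). Qed.

Lemma rI_dense : zdense A U.
Proof. exact: zdenseI (rdom_open g) (rdom_dense f) (rdom_dense g). Qed.

Lemma rI_regl i j : regular A U (fun x => f x i j).
Proof.
by apply: (regularS rI_open _ (@rfun_regular f i j)) => x [].
Qed.

Lemma rI_regr i j : regular A U (fun x => g x i j).
Proof.
by apply: (regularS rI_open _ (@rfun_regular g i j)) => x [].
Qed.

Lemma radd_reg i j : regular A U (fun x => (f x + g x) i j).
Proof.
under [X in regular _ _ X]funext => x do rewrite mxE.
exact: regularD (rI_regl i j) (rI_regr i j).
Qed.

Lemma radd_equiv (h : PGL k n) :
  generic (fun x : X => f (gact h x) + g (gact h x) = conj_act h (f x + g x)).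
Proof.
by apply: generic2 (@rfun_equiv f h) (@rfun_equiv g h) => x -> ->; rewrite conj_actD.
Qed.

Definition radd : ratmap := RatMap rI_open rI_dense radd_reg radd_equiv.

Lemma rmul_reg i j : regular A U (fun x => (f x * g x) i j).
Proof.
under [X in regular _ _ X]funext => x do rewrite mxE.
apply: regular_sum rI_open dom_openX _ => l.
exact: regularM (rI_regl _ _) (rI_regr _ _).
Qed.

Lemma rmul_equiv (h : PGL k n) :
  generic (fun x : X => f (gact h x) * g (gact h x) = conj_act h (f x * g x)).
Proof.
by apply: generic2 (@rfun_equiv f h) (@rfun_equiv g h) => x -> ->; rewrite conj_actM.
Qed.

Definition rmul : ratmap := RatMap rI_open rI_dense rmul_reg rmul_equiv.

Lemma rscale_reg i j : regular A (rdom f) (fun x => (c *: f x) i j).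
Proof.
under [X in regular _ _ X]funext => x do rewrite mxE.
by apply: regularM (@rfun_regular f i j); exact: regular_cst (rdom_open f) dom_openX.
Qed.

Lemma rscale_equiv (h : PGL k n) :
  generic (fun x : X => c *: f (gact h x) = conj_act h (c *: f x)).
Proof. by apply: generic1 (@rfun_equiv f h) => x ->; rewrite conj_actZ. Qed.

Definition rscale : ratmap :=
  RatMap (rdom_open f) (rdom_dense f) rscale_reg rscale_equiv.

End Ops.

Definition kn_scalar (c : k) : kn := \pi_kn (rscalar c).
Definition kn_add : kn -> kn -> kn := lift_op2 kn radd.
Definition kn_mul : kn -> kn -> kn := lift_op2 kn rmul.
Definition kn_scale (c : k) : kn -> kn := lift_op1 kn (rscale^~ c).
Definition kn_opp : kn -> kn := kn_scale (- 1).

Lemma generic_repr (f : ratmap) : generic (fun x : X => f x = repr (\pi_kn f) x).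
Proof. by apply/eq_kn; rewrite reprK. Qed.

Lemma pi_kn_add : {morph \pi_kn : f g / radd f g >-> kn_add f g}.
Proof.
move=> f g; unlock kn_add; apply/eq_kn.
by apply: generic2 (generic_repr f) (generic_repr g) => x /= -> ->.
Qed.

Lemma pi_kn_mul : {morph \pi_kn : f g / rmul f g >-> kn_mul f g}.
Proof.
move=> f g; unlock kn_mul; apply/eq_kn.
by apply: generic2 (generic_repr f) (generic_repr g) => x /= -> ->.
Qed.

Lemma pi_kn_scale c : {morph \pi_kn : f / rscale f c >-> kn_scale c f}.
Proof.
move=> f; unlock kn_scale; apply/eq_kn.
by apply: generic1 (generic_repr f) => x /= ->.
Qed.

Let piE := (=^~ pi_kn_add, =^~ pi_kn_mul, =^~ pi_kn_scale).

Lemma kn_addA : associative kn_add.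
Proof.
elim/quotW=> f; elim/quotW=> g; elim/quotW=> h; rewrite !piE; apply/eq_kn.
by apply: genericT => x; exact: addrA.
Qed.

Lemma kn_addC : commutative kn_add.
Proof.
elim/quotW=> f; elim/quotW=> g; rewrite !piE; apply/eq_kn.
by apply: genericT => x; exact: addrC.
Qed.

Lemma kn_add0 : left_id (kn_scalar 0) kn_add.
Proof.
elim/quotW=> f; rewrite !piE; apply/eq_kn; apply: genericT => x.
by rewrite /= raddf0 add0r.
Qed.

Lemma kn_addN : left_inverse (kn_scalar 0) kn_opp kn_add.
Proof.
elim/quotW=> f; rewrite /kn_opp !piE; apply/eq_kn; apply: genericT => x.
by rewrite /= raddf0 scaleN1r addNr.
Qed.

HB.instance Definition _ :=
  GRing.isZmodule.Build kn kn_addA kn_addC kn_add0 kn_addN.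

Lemma kn_mulA : associative kn_mul.
Proof.
elim/quotW=> f; elim/quotW=> g; elim/quotW=> h; rewrite !piE; apply/eq_kn.
by apply: genericT => x; exact: mulrA.
Qed.

Lemma kn_mul1 : left_id (kn_scalar 1) kn_mul.
Proof.
by elim/quotW=> f; rewrite !piE; apply/eq_kn; apply: genericT => x; exact: mul1r.
Qed.

Lemma kn_mulr1 : right_id (kn_scalar 1) kn_mul.
Proof.
by elim/quotW=> f; rewrite !piE; apply/eq_kn; apply: genericT => x; exact: mulr1.
Qed.

Lemma kn_mulDl : left_distributive kn_mul kn_add.
Proof.
elim/quotW=> f; elim/quotW=> g; elim/quotW=> h; rewrite !piE; apply/eq_kn.
by apply: genericT => x; exact: mulrDl.
Qed.

Lemma kn_mulDr : right_distributive kn_mul kn_add.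
Proof.
elim/quotW=> f; elim/quotW=> g; elim/quotW=> h; rewrite !piE; apply/eq_kn.
by apply: genericT => x; exact: mulrDr.
Qed.

Lemma kn_1neq0 : kn_scalar 1 != kn_scalar 0.
Proof.
apply/eqP => /eq_kn /(generic_ex (igvarP X))[x] /= /eqP.
by rewrite raddf0 oner_eq0.
Qed.

HB.instance Definition _ := GRing.Zmodule_isNzRing.Build kn
  kn_mulA kn_mul1 kn_mulr1 kn_mulDl kn_mulDr kn_1neq0.

Lemma kn_scaleA a b f : kn_scale a (kn_scale b f) = kn_scale (a * b) f.
Proof.
elim/quotW: f => f; rewrite !piE; apply/eq_kn.
by apply: genericT => x; exact: scalerA.
Qed.

Lemma kn_scale1 : left_id 1 kn_scale.
Proof.
by elim/quotW=> f; rewrite !piE; apply/eq_kn; apply: genericT => x; exact: scale1r.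
Qed.

Lemma kn_scaleDr : right_distributive kn_scale +%R.
Proof.
move=> a; elim/quotW=> f; elim/quotW=> g; rewrite -![_ + _]/(kn_add _ _) !piE.
by apply/eq_kn; apply: genericT => x; exact: scalerDr.
Qed.

Lemma kn_scaleDl f : {morph kn_scale^~ f : a b / a + b}.
Proof.
move=> a b; rewrite -[RHS]/(kn_add _ _); elim/quotW: f => f; rewrite !piE.
by apply/eq_kn; apply: genericT => x; exact: scalerDl.
Qed.

HB.instance Definition _ := GRing.Zmodule_isLmodule.Build k kn
  kn_scaleA kn_scale1 kn_scaleDr kn_scaleDl.

Lemma kn_scaleAl (a : k) (f g : kn) : a *: (f * g) = a *: f * g.
Proof.
rewrite -[LHS]/(kn_scale _ (kn_mul _ _)) -[RHS]/(kn_mul (kn_scale _ _) _).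
elim/quotW: f => f; elim/quotW: g => g; rewrite !piE.
by apply/eq_kn; apply: genericT => x; exact: scalerAl.
Qed.

HB.instance Definition _ := GRing.Lmodule_isLalgebra.Build k kn kn_scaleAl.

Lemma kn_scaleAr (a : k) (f g : kn) : a *: (f * g) = f * (a *: g).
Proof.
rewrite -[LHS]/(kn_scale _ (kn_mul _ _)) -[RHS]/(kn_mul _ (kn_scale _ _)).
elim/quotW: f => f; elim/quotW: g => g; rewrite !piE.
by apply/eq_kn; apply: genericT => x; exact: scalerAr.
Qed.

HB.instance Definition _ := GRing.Lalgebra_isAlgebra.Build k kn kn_scaleAr.

End RatMaps.

Definition is_involution (k : pzRingType) (A : algType k) (s : A -> A) : Prop :=
  [/\ linear s, s 1 = 1, forall a b : A, s (a * b) = s b * s a & involutive s].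

(* Main.v *)
(** A fixed group element [g] acts on [X] by a morphism, since freezing the group
    coordinate in a polynomial in the coordinates of [(g, x)] leaves a polynomial
    in those of [x].  Hence transposing [f] composed with [tau] is again a
    rational map; it is equivariant because [tau h = tau(h) tau] and conjugation
    by [(h^-1)^t] is intertwined by transposition with conjugation by [h]. *)
Require Import Defs.
From mathcomp Require Import all_boot all_order all_algebra.
From mathcomp Require Import boolp classical_sets.
From mathcomp Require Import mpoly.

Set Implicit Arguments.
Unset Strict Implicit.
Unset Printing Implicit Defensive.

Import GRing.Theory.
Local Open Scope ring_scope.
Local Open Scope quotient_scope.
Local Open Scope classical_set_scope.

(** Substitute the constants [u] for the first [m] variables and rename the others. Since [q] does
    not depend on [v], one polynomial serves for a whole chart. *)
Lemma meval_row_mxl (k : closedFieldType) (m d : nat) (u : 'rV[k]_m)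
    (p : {mpoly k[m + d]}) :
  exists q : {mpoly k[d]}, forall v : 'rV[k]_d, q.@[v 0] = p.@[row_mx u v 0].
Proof.
pose lq := [tuple match split i with inl a => (u 0 a)%:MP | inr b => 'X_b end
           | i < m + d] : (m + d).-tuple {mpoly k[d]}.
exists (comp_mpoly lq p) => v; rewrite comp_mpoly_meval; apply: meval_eq => i.
rewrite tnth_mktuple mxE; case: (split i) => j; first by rewrite mevalC.
by rewrite mevalXU.
Qed.

Section Translation.
Variables (k : closedFieldType) (G : groupType) (AG : atlas k G).
Variables (X : gvariety AG) (g : G) (i : chart AG).
Hypothesis gi : cdom i g.

Let A := var_atlas X.
Let B := prod_atlas AG A.

Lemma zopen_slice (V : set (G * X)) : zopen B V -> zopen A [set x | V (g, x)].
Proof.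
move=> oV j; have [S HS] := oV (i, j).
exists [set q | exists2 p : {mpoly k[cdim i + cdim j]}, S p &
  forall v : 'rV[k]_(cdim j), q.@[v 0] = p.@[row_mx (ccoord i g) v 0]] => x Dx.
have [VS SV] := HS (g, x) (conj gi Dx).
split=> [/VS[p Sp p0]|[q [p Sp qp]]]; last first.
  by rewrite qp => p0; apply: SV; exists p.
have [q qp] := meval_row_mxl (ccoord i g) p.
by exists q; [exists p | rewrite qp].
Qed.

(** A local quotient [p / q] near [(g, x)] on the product restricts to the slice over [g]: both
    polynomials are frozen at the coordinates of [g] in the chart [i]. *)
Lemma gact_is_morphism : is_morphism A A (gact g).
Proof.
have [cont reg] := gact_morphism X.
split=> [V oV|V f oV rf x j Vx Dx]; first exact: (zopen_slice (cont _ oV)).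
have [W [p [q [oW Wx WV Wq]]]] :=
  reg V f oV rf (g, x) (i, j) Vx (conj gi Dx).
have [p' pE] := meval_row_mxl (ccoord i g) p.
have [q' qE] := meval_row_mxl (ccoord i g) q.
exists [set y | W (g, y)], p', q'; split=> //; first exact: zopen_slice.
  by move=> y /WV[? []].
by move=> y /Wq; rewrite pE qE.
Qed.

End Translation.

Section Star.
Variables (k : closedFieldType) (n : nat) (X : irr_gvariety (PGLtau_atlas k n)).

Let A := var_atlas X.
Let t : X -> X := gact (tau_elt k n).

Lemma gact_tauK : involutive t.
Proof.
move=> x; rewrite /t -gactM -[RHS](gact1 x); congr gact.
rewrite -[LHS]/(PGLtau_mul _ _) /PGLtau_mul /=.
by rewrite -[(_ * _)%g]/(_ * tau 1)%g tau1 mulg1.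
Qed.

Lemma gact_tau_PGL h x :
  t (gact (PGL_incl h) x) = gact (PGL_incl (tau h)) (t x).
Proof.
rewrite /t -!gactM; congr gact.
rewrite -[LHS]/(PGLtau_mul _ _) -[RHS]/(PGLtau_mul _ _) /PGLtau_mul /=.
by rewrite mul1g mulg1.
Qed.

Lemma gact_tau_morphism : is_morphism A A t.
Proof.
(* Freezing the group coordinate takes a chart around [tau_elt]. *)
have [i Di] := dom_cover (PGLtau_is_variety k n) (tau_elt k n).
exact: gact_is_morphism Di.
Qed.

Lemma zopen_tau U : zopen A U -> zopen A (t @^-1` U).
Proof. exact: gact_tau_morphism.1. Qed.

(** As [t] is its own inverse, it carries a point common to [U] and the preimage of [V] to a point
    common to the preimage of [U] and [V]. *)
Lemma zdense_tau U : zdense A U -> zdense A (t @^-1` U).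
Proof.
move=> dU V oV [x Vx]; have [|y [Uy Vy]] := dU _ (zopen_tau oV).
  by exists (t x); rewrite /preimage /= gact_tauK.
by exists (t y); split; rewrite /preimage /= ?gact_tauK.
Qed.

Lemma generic_tau (P : X -> Prop) : generic P -> generic (fun x : X => P (t x)).
Proof.
move=> [U [oU dU UP]]; exists (t @^-1` U).
by split; [exact: zopen_tau | exact: zdense_tau | move=> x /UP].
Qed.

(** The chosen representative of [tau h] is the inverse transpose of that of [h] only up to a scalar
    [c], which cancels in the conjugation. Transposing then reverses the three factors. *)
Lemma conj_act_tau (h : PGL k n) (a : 'M[k]_n.+1) :
  (conj_act (tau h) a)^T = conj_act h a^T.
Proof.
rewrite /conj_act; set r := repr h.
have [c c0 e] : exists2 c : k, c != 0 &
    glval (repr (tau h)) = c *: ((glval r)^-1)^T.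
  rewrite -[h]reprK -/r -[tau _]/(PGLtr (PGLinv _)) -pi_PGLinv -pi_PGLtr.
  exact: (PGL_eq (reprK _)).
have rU : ((glval r)^-1)^T \is a GRing.unit.
  exact: glP (GLtr (GLinv r)).
rewrite e invrZ ?unitfE // -!scalerAl -scalerAr scalerA mulfV // scale1r.
have -> : (((glval r)^-1)^T)^-1 = (glval r)^T.
  by rewrite -[LHS]/(invmx _) -trmx_inv -[invmx _]/(_^-1^-1) invrK.
by rewrite [LHS]trmx_mul trmxK [X in _ *m X]trmx_mul trmxK -mulrA.
Qed.

Section Rstar.
Variable f : ratmap (restrict X).

Lemma rstar_regular i j :
  regular A (t @^-1` rdom f) (fun x => (f (t x))^T i j).
Proof.
under [X in regular _ _ X]funext => x do rewrite mxE.
exact: (gact_tau_morphism.2 _ _ (rdom_open f) (@rfun_regular _ _ _ f j i)).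
Qed.

Lemma rstar_equiv (h : PGL k n) :
  generic (fun x : restrict X =>
    (f (t (gact h x)))^T = conj_act h (f (t x))^T).
Proof.
(* Equivariance of [f] is used for [tau h] at the point [t x], because [t] sends the translate of
   [x] by [h] to the translate of [t x] by [tau h]. *)
apply: generic1 (generic_tau (@rfun_equiv _ _ _ f (tau h))) => x e.
by rewrite -conj_act_tau -e; congr (trmx (f _)); exact: gact_tau_PGL.
Qed.

Definition rstar : ratmap (restrict X) :=
  @RatMap _ _ (restrict X) (fun x => (f (t x))^T) (t @^-1` rdom f)
    (zopen_tau (rdom_open f)) (zdense_tau (rdom_dense f))
    rstar_regular rstar_equiv.

End Rstar.

Definition kn_star : kn (restrict X) -> kn (restrict X) :=
  lift_op1 (kn (restrict X)) rstar.

(** The choice of representative does not matter: maps that agree on a dense open set still agree on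
    one after composition with [t]. *)
Lemma pi_kn_star :
  {morph \pi_(kn (restrict X)) : f / rstar f >-> kn_star f}.
Proof.
move=> f; unlock kn_star; apply/eq_kn.
by apply: generic1 (generic_tau (generic_repr f)) => x /= ->.
Qed.

(** Like the three laws after it, this holds for representatives at every point, where it reduces to
    a property of transposition. *)
Lemma kn_star_linear : linear kn_star.
Proof.
move=> c; elim/quotW=> f; elim/quotW=> g.
rewrite -[LHS]/(kn_star (kn_add (kn_scale _ _) _)).
rewrite -[RHS]/(kn_add (kn_scale _ _) _).
rewrite -!(pi_kn_scale, pi_kn_add, pi_kn_star); apply/eq_kn.
by apply: genericT => x /=; rewrite linearP.
Qed.

Lemma kn_star1 : kn_star 1 = 1.
Proof.
rewrite -[1]/(\pi_(kn _) (rscalar _ 1)) -pi_kn_star; apply/eq_kn.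
by apply: genericT => x /=; rewrite tr_scalar_mx.
Qed.

Lemma kn_starM f g : kn_star (f * g) = kn_star g * kn_star f.
Proof.
elim/quotW: f => f; elim/quotW: g => g.
rewrite -[_ * _]/(kn_mul _ _) -[RHS]/(kn_mul _ _) -!(pi_kn_mul, pi_kn_star).
by apply/eq_kn; apply: genericT => x; exact: trmx_mul.
Qed.

Lemma kn_starK : involutive kn_star.
Proof.
elim/quotW=> f; rewrite -!pi_kn_star; apply/eq_kn.
by apply: genericT => x /=; rewrite gact_tauK trmxK.
Qed.

End Star.

Theorem lemma2p1 (k : closedFieldType) (hk : [pchar k] =i pred0)
    (n : nat) (hn : (2 <= n.+1)%N)
    (X : irr_gvariety (PGLtau_atlas k n))
    (hX : generically_free (restrict X)) :
  exists sigma : kn (restrict X) -> kn (restrict X),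
    (forall f g : ratmap (restrict X),
        sigma (\pi_(kn (restrict X)) f) = \pi_(kn (restrict X)) g ->
        generic (fun x : X => g x = (f (gact (tau_elt k n) x))^T)) /\
    is_involution sigma.
Proof.
exists (@kn_star k n X); split=> [f g|].
  (* The hypothesis now says that [rstar f] and [g] have the same class, that is, agree
     generically. *)
  by rewrite -pi_kn_star => /esym /eq_kn.
split; [exact: kn_star_linear | exact: kn_star1 | exact: kn_starM |].
exact: kn_starK.
Qed.
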